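(* Let $n, k, t$ be integers with $t \geq 1$ and $n \geq (k-t+1)(t+1)$. Let $\mathcal{F}$ be a family of subsets of $[n]=\{1,\dots,n\}$, each of size at most $k$. Suppose that for any $A, B \in \mathcal{F}$ with $|A \cap B| < t$, we have $|A \triangle B| \leq k-t$. Then $$|\mathcal{F}| \leq \binom{n-t}{k-t} + \binom{n-t}{k-1-t} + \cdots + \binom{n-t}{0}.$$
   Context: $A \triangle B$ denotes the symmetric difference $(A\setminus B)\cup(B\setminus A)$. *)

(* Defs.v *)
From mathcomp Require Import all_boot.
Set Implicit Arguments. Unset Strict Implicit. Unset Printing Implicit Defensive.

Definition symdiff (T : finType) (A B : {set T}) : {set T} := (A :\: B) :|: (B :\: A).

(* Main.v *)
Require Import Defs.
From mathcomp Require Import all_boot zify.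
(** Among the families of maximum size satisfying the condition, take one whose
    total weight is largest, where [x] weighs [n - x].  Adding a point to the sets
    of size less than [k] preserves the condition, so the family is closed under
    enlargement up to size [k]; since two sets satisfying the condition, one of
    size [k], always meet in [t] points, the family is t-intersecting.  It is then
    also stable under shifts.

    The rest is a version of the Ahlswede-Khachatryan pushing-pulling argument.
    Let [s] be least such that every member of the family has its trace on
    {0, .., s-1} in the family.  If [s <= t], every member contains
    {0, .., t-1} and the bound is immediate.  Otherwise consider the pivots, the
    members inside {0, .., s-1} that contain [s-1] and leave the family when it
    is removed: by shiftedness two pivots meeting in exactly [t] points cover
    {0, .., s-1}, so their sizes sum to [s+t].  If some pivot has size
    [i <> (s+t)/2], removing [s-1] from the pivots of size [i] and discarding
    those of size [s+t-i], or the other way round, yields a larger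
    t-intersecting family.  If all pivots have size [(s+t)/2], the same works for
    some [m < s-1], removing [s-1] from the pivots that miss [m] and discarding
    those that contain [m]; this is where [n >= (k-t+1)(t+1)] is needed. *)

Set Implicit Arguments. Unset Strict Implicit. Unset Printing Implicit Defensive.

(** * Compressions of a family *)

Definition compress (T : finType) (f : T -> T) (F : {set T}) : {set T} :=
  [set (if f A \in F then A else f A) | A in F].

(** A kept member lies in [F] and the image of a moved one does not, so collisions can only occur
    between two moved members. *)
Lemma compress_inj (T : finType) (f : T -> T) (F : {set T}) :
  {in [pred A in F | f A \notin F] &, injective f} ->
  {in F &, injective (fun A => if f A \in F then A else f A)}.
Proof.
move=> f_inj A B AF BF; case: ifPn => fA; case: ifPn => fB // eqAB.
- by rewrite -eqAB AF in fB.
- by rewrite eqAB BF in fA.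
- by apply: f_inj => //; rewrite inE ?AF ?BF.
Qed.

Lemma card_compress (T : finType) (f : T -> T) (F : {set T}) :
  {in [pred A in F | f A \notin F] &, injective f} -> #|compress f F| = #|F|.
Proof. by move=> /compress_inj f_inj; rewrite card_in_imset. Qed.

Lemma sum_compress_lt (T : finType) (f : T -> T) (F : {set T}) (w : T -> nat) A0 :
  {in [pred A in F | f A \notin F] &, injective f} ->
  (forall A, A \in F -> f A \notin F -> w A < w (f A)) ->
  A0 \in F -> f A0 \notin F ->
  \sum_(A in F) w A < \sum_(A in compress f F) w A.
Proof.
move=> /compress_inj f_inj w_lt A0F fA0; rewrite big_imset //=.
rewrite [X in X < _](bigD1 A0) // [X in _ < X](bigD1 A0) //= (negPf fA0).
rewrite -addSn leq_add ?w_lt //; apply: leq_sum => A /andP[AF _].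
by case: ifPn => // fA; apply/ltnW/w_lt.
Qed.

(** * The symmetric difference condition *)

Lemma card_symdiff (T : finType) (A B : {set T}) :
  #|symdiff A B| + 2 * #|A :&: B| = #|A| + #|B|.
Proof.
rewrite /symdiff cardsU (_ : (A :\: B) :&: (B :\: A) = set0); last first.
  by apply/setP=> x; rewrite !inE; case: (x \in A); case: (x \in B).
rewrite cards0; have := cardsID B A; have := cardsID A B; rewrite (setIC B A); lia.
Qed.

Definition t_intersecting (T : finType) (t : nat) (F : {set {set T}}) : Prop :=
  forall A B, A \in F -> B \in F -> t <= #|A :&: B|.

(** The second clause is $|A \triangle B| + t \le k$, freed of subtraction by [card_symdiff]. *)
Definition meet_or_close (T : finType) (k t : nat) (A B : {set T}) : bool :=
  (t <= #|A :&: B|) || (#|A| + #|B| + t <= k + 2 * #|A :&: B|).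

Definition admissible (T : finType) (k t : nat) (F : {set {set T}}) : bool :=
  [forall A in F, #|A| <= k] &&
  [forall A in F, [forall B in F, meet_or_close k t A B]].

Lemma admissibleP (T : finType) (k t : nat) (F : {set {set T}}) :
  reflect ((forall A, A \in F -> #|A| <= k) /\
           (forall A B, A \in F -> B \in F -> meet_or_close k t A B))
          (admissible k t F).
Proof.
apply: (iffP andP) => -[h1 h2]; split.
- by move=> A AF; move/forall_inP: h1; apply.
- by move=> A B AF BF; move/forall_inP: h2 => /(_ A AF) /forall_inP; apply.
- by apply/forall_inP.
- by apply/forall_inP => A AF; apply/forall_inP => B BF; apply: h2.
Qed.

Lemma t_intersecting_admissible (T : finType) (k t : nat) (F : {set {set T}}) :
  (forall A, A \in F -> #|A| <= k) -> t_intersecting t F -> admissible k t F.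
Proof.
move=> hk ht; apply/admissibleP; split=> // A B AF BF.
by rewrite /meet_or_close ht.
Qed.

(** * Enlarging sets by a point *)

Definition augment (T : finType) (k : nat) (x : T) (A : {set T}) : {set T} :=
  if #|A| < k then x |: A else A.

Lemma augment_inj (T : finType) (k : nat) (x : T) (F : {set {set T}}) :
  {in [pred A in F | augment k x A \notin F] &, injective (augment k x)}.
Proof.
have moved A : A \in [pred A in F | augment k x A \notin F] ->
    augment k x A = x |: A /\ x \notin A.
  rewrite inE /= /augment => /andP[AF]; case: ifP => [_ h|_]; last by rewrite AF.
  by split=> //; apply: contra h => xA; rewrite (setUidPr _) ?sub1set.
move=> A B /moved[-> xA] /moved[-> xB] /(congr1 (fun C => C :\ x)).
by rewrite !setU1K.
Qed.

Lemma cardsIU1 (T : finType) (x : T) (A B : {set T}) :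
  x \notin A -> #|(x |: A) :&: B| = (x \in B) + #|A :&: B|.
Proof.
move=> xA; rewrite setIUl; case: (boolP (x \in B)) => xB.
  by rewrite (setIidPl _) ?sub1set // cardsU1 !inE (negPf xA).
rewrite (_ : [set x] :&: B = set0) ?set0U //.
by apply/eqP; rewrite setI_eq0 disjoints1.
Qed.

(* A moved set meets an unmoved set B with |B| = k well because two sets, one of
   size k, that satisfy the condition always meet in at least t elements. *)
Lemma augment_admissible (T : finType) (k t : nat) (x : T) (F : {set {set T}}) :
  admissible k t F -> admissible k t (compress (augment k x) F).
Proof.
move=> /admissibleP[hk hF]; apply/admissibleP; split.
  move=> _ /imsetP[A AF ->]; case: ifP => [_|_]; first exact: hk.
  by rewrite /augment; case: ifP => h; [rewrite cardsU1; lia | exact: hk].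
have mixed A B : A \in F -> augment k x A \notin F -> B \in F -> augment k x B \in F ->
    meet_or_close k t (augment k x A) B.
  rewrite /augment => AF; case: ifPn => hA; last by rewrite AF.
  move=> xAF BF xBF; have xA : x \notin A.
    by apply: contra xAF => xA; rewrite (setUidPr _) ?sub1set.
  have := hF A B AF BF; have := hk _ BF; have := hF A _ AF xBF.
  rewrite /meet_or_close (cardsIU1 _ xA) cardsU1 xA /=.
  have := subset_leq_card (subsetIl A B).
  case: ifP => hB; last by lia.
  have [xB|xB] := boolP (x \in B); first by lia.
  (* Here [x |: B] is in [F], and the condition for [A] and [x |: B] is numerically the one wanted
     for [x |: A] and [B]. *)
  have xB0 : #|A :&: (x |: B)| = #|A :&: B|.
    by rewrite setIC cardsIU1 // (negPf xA) setIC.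
  rewrite xB0 cardsU1 xB /=; lia.
have sym A B : meet_or_close k t A B = meet_or_close k t B A.
  by rewrite /meet_or_close setIC (addnC #|A|).
move=> _ _ /imsetP[A AF ->] /imsetP[B BF ->]; case: ifPn => hA; case: ifPn => hB.
- exact: hF.
- by rewrite sym; apply: mixed.
- exact: mixed.
move: hA hB; rewrite /augment; case: ifP => _; last by rewrite AF.
case: ifP => _; last by rewrite BF.
move=> hA hB.
have xA : x \notin A by apply: contra hA => xA; rewrite (setUidPr _) ?sub1set.
have xB : x \notin B by apply: contra hB => xB; rewrite (setUidPr _) ?sub1set.
(* Both sizes and the intersection grow by one, so the second clause keeps its balance. *)
have := hF A B AF BF.
rewrite /meet_or_close (cardsIU1 _ xA) !cardsU1 xA xB setU11 (setIC A (x |: B)) (cardsIU1 _ xB).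
by rewrite (negPf xA) (setIC B A) /=; lia.
Qed.

(** * Shifts *)

Definition shift (T : finType) (i j : T) (A : {set T}) : {set T} :=
  if (i \in A) && (j \notin A) then j |: (A :\ i) else A.

Lemma shift_inj (T : finType) (i j : T) (F : {set {set T}}) :
  {in [pred A in F | shift i j A \notin F] &, injective (shift i j)}.
Proof.
have moved A : A \in [pred A in F | shift i j A \notin F] ->
    i |: (shift i j A :\ j) = A.
  rewrite inE /= /shift => /andP[AF]; case: ifP => [/andP[iA jA] _|_]; last by rewrite AF.
  by rewrite setU1K ?setD1K // !inE negb_and jA orbT.
by move=> A B /moved {2}<- /moved {2}<- ->.
Qed.

Lemma card_shift (T : finType) (i j : T) (A : {set T}) : #|shift i j A| = #|A|.
Proof.
rewrite /shift; case: ifP => // /andP[iA jA].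
by rewrite cardsU1 (cardsD1 i A) iA !inE negb_and jA orbT.
Qed.

(** The critical case is [A] moved and [B] kept with [i] in [B] and [j] outside. Then [shift i j B]
    is in [F], and [A] meets it inside [(A :\ i) :&: B]. *)
Lemma shift_t_intersecting (T : finType) (t : nat) (i j : T) (F : {set {set T}}) :
  t_intersecting t F -> t_intersecting t (compress (shift i j) F).
Proof.
move=> hF.
have mixed A B : A \in F -> shift i j A \notin F -> B \in F -> shift i j B \in F ->
    t <= #|shift i j A :&: B|.
  rewrite /shift => AF; case: ifPn => [/andP[iA jA] _|_]; last by rewrite AF.
  have jAi : j \notin A :\ i by rewrite !inE negb_and jA orbT.
  move=> BF; rewrite (cardsIU1 _ jAi).
  have [iB|iB] /= := boolP (i \in B); last first.
    move=> _; apply: leq_trans (hF A B AF BF) _; apply: leq_trans (leq_addl _ _).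
    apply/subset_leq_card/subsetP => x; rewrite !inE => /andP[xA xB].
    by rewrite xA xB; case: eqP => // eq_xi; rewrite -eq_xi xB in iB.
  have AiB : (A :\ i) :&: B = (A :&: B) :\ i.
    by apply/setP=> x; rewrite !inE andbA.
  have := hF A B AF BF; rewrite (cardsD1 i (A :&: B)) !inE iA iB AiB.
  have [jB|jB] //= := boolP (j \in B).
  move=> _ jBF; apply: leq_trans (hF _ _ AF jBF) _; rewrite add0n.
  apply/subset_leq_card/subsetP=> x; rewrite !inE => /andP[xA /orP[/eqP eq_xj|/andP[-> ->]]].
    by rewrite -eq_xj xA in jA.
  by rewrite xA.
move=> _ _ /imsetP[A AF ->] /imsetP[B BF ->]; case: ifPn => hA; case: ifPn => hB.
- exact: hF.
- by rewrite setIC; apply: mixed.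
- exact: mixed.
move: hA hB; rewrite /shift; case: ifP => [/andP[iA jA] _|_]; last by rewrite AF.
case: ifP => [/andP[iB jB] _|_]; last by rewrite BF.
apply: leq_trans (hF A B AF BF) _.
rewrite -setUIr cardsU1 (cardsD1 i (A :&: B)) !inE iA iB (negPf jA) andbF /= leq_add2l.
by apply/subset_leq_card/subsetP=> x; rewrite !inE => /and3P[-> -> ->].
Qed.

(** * Counting sets with a given trace on an initial segment *)

Lemma card_small_subsets (T : finType) (S : {set T}) (m : nat) :
  #|[set A : {set T} | (A \subset S) && (#|A| < m)]| = \sum_(j < m) 'C(#|S|, j).
Proof.
elim: m => [|m IHm]; first by rewrite big_ord0; apply: eq_card0 => A; rewrite !inE andbF.
rewrite big_ord_recr /= -IHm -cards_draws -cardsUI.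
rewrite (_ : _ :&: _ = set0) ?cards0 ?addn0; last first.
  by apply/setP=> A; rewrite !inE; case: (A \subset S) => //=; lia.
by apply: eq_card => A; rewrite !inE; case: (A \subset S) => //=; lia.
Qed.

Definition seg (n s : nat) : {set 'I_n} := [set x : 'I_n | x < s].

Lemma card_seg (n s : nat) : s <= n -> #|seg n s| = s.
Proof.
move=> sn; have widen_inj : injective (widen_ord sn).
  by move=> x y /(congr1 val) /= /val_inj.
rewrite -[RHS]card_ord -(card_imset _ widen_inj).
apply: eq_card => x; rewrite inE; apply/idP/imsetP => [xs|[y _ ->]]; last exact: ltn_ord y.
by exists (Ordinal xs) => //; apply: val_inj.
Qed.

Definition cells (n k s : nat) (X : {set {set 'I_n}}) : {set {set 'I_n}} :=
  [set A | (A :&: seg n s \in X) && (#|A| <= k)].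

Lemma card_cell (n k s : nat) (E : {set 'I_n}) :
  s <= n -> E \subset seg n s ->
  #|cells k s [set E]| = \sum_(j < k.+1 - #|E|) 'C(n - s, j).
Proof.
move=> sn Es; have cardC : #|~: seg n s| = n - s.
  by have := cardsC (seg n s); rewrite card_seg // card_ord; lia.
rewrite -cardC -card_small_subsets.
have disE (C : {set 'I_n}) : C \subset ~: seg n s -> C :&: E = set0.
  by move=> Cs; apply/eqP; rewrite setI_eq0 disjoints_subset (subset_trans Cs) // setCS.
rewrite -(card_in_imset (f := fun C : {set _} => C :|: E)); last first.
  have cancelE (C : {set 'I_n}) : C :&: E = set0 -> (C :|: E) :\: E = C.
    by move=> CE; rewrite setDUl setDv setU0; apply/setDidPl; rewrite -setI_eq0 CE.
  move=> C D; rewrite !inE => /andP[/disE/cancelE CE _] /andP[/disE/cancelE DE _] eqCD.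
  by rewrite -CE eqCD.
apply: eq_card => A; rewrite !inE; apply/andP/imsetP => [[/eqP AE Ak]|[C]].
  have EA : E \subset A by rewrite -AE subsetIl.
  exists (A :\: E); last by rewrite setUC -{1}(setIidPr EA) setID.
  have := cardsID E A; rewrite inE (setIidPr EA) => cA; apply/andP; split; last by lia.
  by apply/subsetP=> x; rewrite -AE !inE => /andP[]; case: (x \in A); rewrite //= andbT.
rewrite inE => /andP[Cs Cm] ->; split; last by rewrite cardsU; lia.
rewrite setIUl (setIidPl Es) (_ : C :&: _ = set0) ?set0U //.
by apply/eqP; rewrite setI_eq0 disjoints_subset.
Qed.

Lemma card_cells (n k s i : nat) (X : {set {set 'I_n}}) :
  s <= n -> (forall E, E \in X -> E \subset seg n s /\ #|E| = i) ->
  #|cells k s X| = #|X| * \sum_(j < k.+1 - i) 'C(n - s, j).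
Proof.
move=> sn hX; rewrite -sum1_card (partition_big (fun A => A :&: seg n s) (mem X)) /=.
  rewrite -sum_nat_const; apply: eq_bigr => E EX; have [Es <-] := hX E EX.
  rewrite -card_cell // -sum1_card; apply: eq_bigl => A; rewrite !inE.
  by case: eqP => [->|]; rewrite ?EX ?andbT ?andbF.
by move=> A; rewrite inE => /andP[].
Qed.

(** Term [j] on the left is compared with term [j.+1] on the right: their ratio $(M-j)/(j+1)$ is
    smallest at $j = e$. The unmatched term $\binom{M}{0}$ gives strictness. *)
Lemma binomial_sum_ratio (M e u v : nat) :
  0 < u -> v * e.+1 <= u * (M - e) ->
  v * \sum_(j < e.+1) 'C(M, j) < u * \sum_(j < e.+2) 'C(M, j).
Proof.
move=> u0 huv; rewrite [X in _ < _ * X]big_ord_recl bin0 mulnDr muln1.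
rewrite -addn1 addnC leq_add // !big_distrr leq_sum // => j _.
rewrite lift0 -(leq_pmul2l (ltn0Sn j)) [X in _ <= X]mulnCA mul_bin_left.
rewrite !mulnA leq_mul2r; apply/orP; right.
by have := ltn_ord j; nia.
Qed.

(** * Extremal families: weights and t-intersection *)

Definition weight (n : nat) (A : {set 'I_n}) : nat := \sum_(x in A) (n - x).

Lemma weight_augment (n k : nat) (x : 'I_n) (A : {set 'I_n}) (F : {set {set 'I_n}}) :
  A \in F -> augment k x A \notin F -> weight A < weight (augment k x A).
Proof.
rewrite /augment => AF; case: ifP => [_ xA|_]; last by rewrite AF.
have {}xA : x \notin A by apply: contra xA => xA; rewrite (setUidPr _) ?sub1set.
by rewrite /weight big_setU1 //=; have := ltn_ord x; lia.
Qed.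

Lemma weight_shift (n : nat) (i j : 'I_n) (A : {set 'I_n}) (F : {set {set 'I_n}}) :
  j < i -> A \in F -> shift i j A \notin F -> weight A < weight (shift i j A).
Proof.
rewrite /shift => ji AF; case: ifP => [/andP[iA jA] _|_]; last by rewrite AF.
rewrite /weight big_setU1 /= ?(big_setD1 i iA) /=; last by rewrite !inE negb_and jA orbT.
by rewrite ltn_add2r; have := ltn_ord i; lia.
Qed.

Lemma exists_max_admissible (n k t : nat) (F : {set {set 'I_n}}) :
  admissible k t F ->
  exists G : {set {set 'I_n}},
    [/\ admissible k t G, #|F| <= #|G|,
        forall G' : {set {set 'I_n}}, admissible k t G' -> #|G'| <= #|G| &
        forall G' : {set {set 'I_n}}, admissible k t G' -> #|G'| = #|G| ->
          \sum_(A in G') weight A <= \sum_(A in G) weight A].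
Proof.
move=> Fadm; case: (arg_maxnP (fun G : {set {set 'I_n}} => #|G|) Fadm) => G1 G1adm G1max.
have G1P : admissible k t G1 && (#|G1| == #|G1|) by rewrite G1adm /=.
case: (@arg_maxnP _ G1 (fun G => admissible k t G && (#|G| == #|G1|))
  (fun G : {set {set 'I_n}} => \sum_(A in G) weight A) G1P) => G /andP[Gadm /eqP eqG] Gmax.
exists G; rewrite eqG; split=> //; first exact: G1max.
by move=> G' G'adm eqG'; apply: Gmax; rewrite G'adm eqG' /=.
Qed.

(** If [A] and [B] met in fewer than [t] points, [A] could grow to size [k] by points outside [B],
    leaving the intersection unchanged; at size [k] the condition forces [t] common points. *)
Lemma upclosed_t_intersecting (T : finType) (k t : nat) (F : {set {set T}}) :
  1 <= t -> (k.+1 - t) * t.+1 <= #|T| -> admissible k t F ->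
  (forall x A, A \in F -> augment k x A \in F) -> t_intersecting t F.
Proof.
move=> t1 nT /admissibleP[hk hF] hup A B AF BF; rewrite leqNgt; apply/negP => ABt.
(* With $d = k-t$: $(d+1)(t+1) = dt+d+t+1 > 2d+t$, as $t \ge 1$. *)
have nT' : t <= k -> 2 * k - t < #|T| by nia.
have [C [CF Ck CB]] : exists C, [/\ C \in F, #|C| = k & C :&: B = A :&: B].
  have bound (C : {set T}) : C :&: B = A :&: B -> #|C| < k -> exists2 x, x \notin C & x \notin B.
    move=> CB Ck; have : ~: (C :|: B) != set0.
      rewrite -card_gt0; have := cardsC (C :|: B); rewrite cardsU CB.
      have := hF A B AF BF; rewrite /meet_or_close; have := hk B BF.
      have := subset_leq_card (subsetIl A B); have := subset_leq_card (subsetIr A B); lia.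
    by case/set0Pn => x; rewrite !inE negb_or => /andP[xC xB]; exists x.
  have grow m : m + #|A| <= k ->
      exists C, [/\ C \in F, #|C| = m + #|A| & C :&: B = A :&: B].
    elim: m => [|m IHm] hm; first by exists A.
    have [C [CF Cm CB]] := IHm (ltnW hm).
    have Ck : #|C| < k by rewrite Cm.
    have [x xC xB] := bound C CB Ck.
    exists (x |: C); split; first by have := hup x C CF; rewrite /augment Ck.
      by rewrite cardsU1 xC Cm.
    rewrite setIUl CB (_ : [set x] :&: B = set0) ?set0U //.
    by apply/eqP; rewrite setI_eq0 disjoints1.
  have [|C [CF Ck CB]] := grow (k - #|A|); first by rewrite subnK ?hk.
  by exists C; rewrite Ck subnK ?hk.
have := hF C B CF BF; rewrite /meet_or_close CB Ck.
have := subset_leq_card (subsetIr A B); lia.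
Qed.

(** * Pivots and the pushing-pulling exchange *)

(** These are the traces that prevent shortening the segment [seg n r.+1] to [seg n r]. *)
Definition pivots (n : nat) (r : 'I_n) (F : {set {set 'I_n}}) : {set {set 'I_n}} :=
  [set E in F | [&& E \subset seg n r.+1, r \in E & E :\ r \notin F]].

(** If both sets missed some [y < r], shifting [r] to [y] in [E2] would cost the common point [r]
    and gain none, leaving fewer than [t]. *)
Lemma pivots_cover (n t : nat) (r : 'I_n) (F : {set {set 'I_n}}) E1 E2 :
  t_intersecting t F ->
  (forall (i j : 'I_n) A, j < i -> A \in F -> shift i j A \in F) ->
  E1 \in pivots r F -> E2 \in pivots r F -> #|E1 :&: E2| <= t ->
  E1 :|: E2 = seg n r.+1.
Proof.
move=> hF hshift; rewrite !inE => /and4P[F1 S1 r1 _] /and4P[F2 S2 r2 _] E12.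
apply/eqP; rewrite eqEsubset subUset S1 S2; apply/subsetP => y; rewrite inE ltnS => yr.
rewrite inE; apply/negPn; rewrite negb_or; apply/negP => /andP[y1 y2].
have {}yr : y < r.
  by rewrite ltn_neqAle yr andbT; apply: contra y1 => /eqP/val_inj ->.
have := hF E1 _ F1 (hshift r y E2 yr F2); rewrite /shift r2 y2 /=.
move: E12; rewrite (cardsD1 r) !inE r1 r2 /= => E12; apply/negP; rewrite -ltnNge.
apply: leq_ltn_trans E12; apply/subset_leq_card/subsetP => x; rewrite !inE.
by case/andP => x1 /orP[/eqP xy|/andP[-> ->]]; [rewrite -xy x1 in y1 | rewrite x1].
Qed.

Lemma pivots_card (n t : nat) (r : 'I_n) (F : {set {set 'I_n}}) E1 E2 :
  t_intersecting t F ->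
  (forall (i j : 'I_n) A, j < i -> A \in F -> shift i j A \in F) ->
  E1 \in pivots r F -> E2 \in pivots r F -> #|E1 :&: E2| <= t ->
  #|E1| + #|E2| = r.+1 + t.
Proof.
move=> hF hshift E1p E2p E12; rewrite -cardsUI (pivots_cover hF hshift E1p E2p E12).
rewrite card_seg ?ltn_ord //; congr (_ + _); apply/eqP; rewrite eqn_leq E12.
by apply: hF; [move: E1p | move: E2p]; rewrite inE => /andP[].
Qed.

(* Members of the family whose trace is in [Bd] are replaced by all sets whose
   trace is [E :\ r] for some [E] in [H]. *)
Lemma pivots_exchange (n k t i j : nat) (r : 'I_n) (F H Bd : {set {set 'I_n}}) :
  (forall A, A \in F -> #|A| <= k) -> t_intersecting t F ->
  (forall G : {set {set 'I_n}}, (forall A, A \in G -> #|A| <= k) ->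
     t_intersecting t G -> #|G| <= #|F|) ->
  (forall A, A \in F -> A :&: seg n r.+1 \in F) ->
  H \subset pivots r F -> Bd \subset pivots r F ->
  (forall E, E \in H -> #|E| = i) -> (forall E, E \in Bd -> #|E| = j) ->
  (forall E E', E \in H -> E' \in pivots r F -> #|E :&: E'| <= t -> E' \in Bd) ->
  {in H &, forall E E', t < #|E :&: E'|} ->
  #|H| * \sum_(l < k.+1 - i.-1) 'C(n - r.+1, l) <=
  #|Bd| * \sum_(l < k.+1 - j) 'C(n - r.+1, l).
Proof.
move=> hk hF hmax htr /subsetP Hp /subsetP Bp Hi Bj hconf hHH.
have pivP E : E \in pivots r F -> [/\ E \in F, E \subset seg n r.+1, r \in E & E :\ r \notin F].
  by rewrite inE => /and4P.
set H' := [set E :\ r | E in H].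
have cardH' : #|H'| = #|H|.
  apply: card_in_imset => E E' /Hp/pivP[_ _ rE _] /Hp/pivP[_ _ rE' _] eqE.
  by rewrite -(setD1K rE) eqE setD1K.
have cellsF : [disjoint F & cells k r.+1 H'].
  apply/pred0P => A /=; apply/negP => /andP[AF]; rewrite inE => /andP[/imsetP[E EH AE] _].
  by have [_ _ _] := pivP E (Hp E EH); rewrite -AE htr.
have cardB : #|cells k r.+1 Bd| = #|Bd| * \sum_(l < k.+1 - j) 'C(n - r.+1, l).
  by apply: card_cells => // E EB; rewrite Bj //; have [] := pivP E (Bp E EB).
have cardH : #|cells k r.+1 H'| = #|H| * \sum_(l < k.+1 - i.-1) 'C(n - r.+1, l).
  rewrite -cardH'; apply: card_cells => // _ /imsetP[E EH ->].
  have [_ Es rE _] := pivP E (Hp E EH); rewrite (subset_trans (subD1set _ _)) //.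
  by split=> //; rewrite -(Hi E EH) [in RHS](cardsD1 r E) rE.
have : #|(F :\: cells k r.+1 Bd) :|: cells k r.+1 H'| <= #|F|.
  have mixed A B : A \in F -> A \notin cells k r.+1 Bd -> B \in cells k r.+1 H' ->
      t <= #|A :&: B|.
    move=> AF AB; rewrite inE => /andP[/imsetP[E EH BE] _].
    have [EF Es rE Er] := pivP E (Hp E EH); set A' := A :&: seg n r.+1.
    apply: (@leq_trans #|(E :\ r) :&: A'|); last first.
      by rewrite -BE setIACA setIid (setIC A); apply/subset_leq_card/subsetIl.
    have A'F : A' \in F by exact: htr.
    have inter D : (E :\ r) :&: D = (E :&: D) :\ r by rewrite !setDE setIAC.
    have [rA|rA] := boolP (r \in A'); last first.
      by have := hF E A' EF A'F; rewrite inter (cardsD1 r (E :&: A')) in_setI (negPf rA) andbF.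
    (* Either [r] can be removed from [A'] instead of [E], or [A'] is a pivot outside [Bd] and so
       meets [E] in more than [t] points. *)
    have [A'r|A'r] := boolP (A' :\ r \in F).
      by rewrite inter -setIDA; apply: hF.
    have A'p : A' \in pivots r F by rewrite inE A'F rA A'r subsetIr.
    have : t < #|E :&: A'|.
      rewrite ltnNge; apply: contra AB => EA; rewrite inE (hconf E) ?hk //.
    by rewrite inter (cardsD1 r (E :&: A')) in_setI rE rA.
  apply: hmax => [A|A B].
    rewrite !inE => /orP[/andP[_ /hk //]|/andP[_ //]].
  rewrite in_setU in_setD => /orP[/andP[AB AF]|AH];
    rewrite in_setU in_setD => /orP[/andP[BB BF]|BH].
  - exact: hF.
  - exact: mixed.
  - by rewrite setIC; apply: mixed.
  move: AH BH; rewrite !inE => /andP[/imsetP[E EH AE] _] /andP[/imsetP[E' EH' BE] _].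
  apply: (@leq_trans #|(A :&: seg n r.+1) :&: (B :&: seg n r.+1)|); last first.
    by rewrite setIACA; apply/subset_leq_card/subsetIl.
  have := hHH E E' EH EH'; rewrite AE BE -setDIl (cardsD1 r) inE.
  by have [_ _ -> _] := pivP E (Hp E EH); have [_ _ -> _] := pivP E' (Hp E' EH').
rewrite cardsU (_ : _ :&: _ = set0) ?cards0 ?subn0; last first.
  by apply/eqP; rewrite setI_eq0 (disjointWl (subsetDl _ _)).
have := cardsID (cells k r.+1 Bd) F; have := subset_leq_card (subsetIr F (cells k r.+1 Bd)).
rewrite cardB cardH; lia.
Qed.

Lemma pivots_eq0 (n k t : nat) (r : 'I_n) (F : {set {set 'I_n}}) :
  1 <= t -> (k.+1 - t) * t.+1 <= n ->
  (forall A, A \in F -> #|A| <= k) -> t_intersecting t F ->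
  (forall G : {set {set 'I_n}}, (forall A, A \in G -> #|A| <= k) ->
     t_intersecting t G -> #|G| <= #|F|) ->
  (forall (i j : 'I_n) A, j < i -> A \in F -> shift i j A \in F) ->
  (forall A, A \in F -> A :&: seg n r.+1 \in F) ->
  t <= r -> pivots r F = set0.
Proof.
move=> t1 hn hk hF hmax hshift htr tr; set P := pivots r F.
(* [N i] counts the sets of size at most [k] with a given trace of size [i]. *)
set N := fun i => \sum_(l < k.+1 - i) 'C(n - r.+1, l).
have pivP E : E \in P -> [/\ E \in F, E \subset seg n r.+1 & r \in E].
  by rewrite inE => /and4P[].
have cardP E : E \in P -> 0 < #|E| <= k.
  by move=> /pivP[EF _ rE]; rewrite hk // andbT card_gt0; apply/set0Pn; exists r.
have pairP E E' : E \in P -> E' \in P -> #|E :&: E'| <= t -> #|E| + #|E'| = r.+1 + t.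
  exact: pivots_card.
pose L (i : nat) := [set E in P | #|E| == i].
have Nstep i : i <= k -> 0 < i -> N i.-1 = N i + 'C(n - r.+1, k.+1 - i).
  move=> ik i0; rewrite /N (_ : k.+1 - i.-1 = (k.+1 - i).+1); last by lia.
  by rewrite big_ord_recr.
have [/exists_inP[E EP Ei]|/exists_inPn mid] := boolP [exists E in P, #|E| + #|E| != r.+1 + t].
  (* Pivots of size [i] meet pairwise in more than [t] points, since [i + i] is not [r.+1 + t]. *)
  have level i j : i + j = r.+1 + t -> i + i != r.+1 + t -> #|L i| * N i.-1 <= #|L j| * N j.
    move=> ij ii; have LP l : L l \subset P by apply/subsetP => D; rewrite inE => /andP[].
    have Lc l D : D \in L l -> #|D| = l by rewrite inE => /andP[_ /eqP].
    apply: (pivots_exchange hk hF hmax htr (LP i) (LP j) (Lc i) (Lc j)).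
      move=> D D'; rewrite inE => /andP[DP /eqP Di] D'P /(pairP D D' DP D'P).
      by rewrite inE D'P Di -ij /= => /addnI ->.
    move=> D D'; rewrite inE => /andP[DP /eqP Di]; rewrite inE => /andP[D'P /eqP D'i].
    by rewrite ltnNge; apply: contra ii => /(pairP D D' DP D'P); rewrite Di D'i => ->.
  have [/andP[i0 ik] [_ Es _]] := (cardP E EP, pivP E EP).
  have := subset_leq_card Es; rewrite card_seg ?ltn_ord // => is_.
  have ij : #|E| + (r.+1 + t - #|E|) = r.+1 + t by lia.
  move: ij; set i := #|E|; set j := r.+1 + t - i => ij.
  have h1 := level i j ij Ei; have h2 := level j i; rewrite addnC ij in h2.
  have {}h2 := h2 erefl; have jj : j + j != r.+1 + t by move: Ei; lia.
  have {}h2 := h2 jj.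
  have Li : 0 < #|L i| by rewrite card_gt0; apply/set0Pn; exists E; rewrite inE EP /=.
  have Ni : 0 < N i.-1.
    by rewrite /N (_ : k.+1 - i.-1 = (k.+1 - i).+1) ?big_ord_recl ?bin0 //; lia.
  have Lj : 0 < #|L j|.
    by move: h1; rewrite lt0n; apply: contraTneq => ->; rewrite mul0n -ltnNge muln_gt0 Li.
  have /andP[j0 jk] : 0 < j <= k.
    by move: Lj; rewrite card_gt0 => /set0Pn[D]; rewrite inE => /andP[/cardP DP /eqP <-].
  have nk : 2 * k - t < n by nia.
  (* This makes $N(j) < N(j-1)$, so $|L_j| N(j-1) \le |L_i| N(i) \le |L_i| N(i-1) \le |L_j| N(j)$ is
     absurd. *)
  have : 0 < 'C(n - r.+1, k.+1 - j) by rewrite bin_gt0; lia.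
  move: h1 h2; rewrite !Nstep // !mulnDr; nia.
apply/eqP/set0Pn => -[E0 E0P]; set i := #|E0|.
have Pi E : E \in P -> #|E| = i.
  by move=> EP; have := mid E EP; have := mid E0 E0P; rewrite !negbK; lia.
have := mid E0 E0P; rewrite negbK -/i => /eqP i2; have /andP[i0 ik] := cardP E0 E0P.
rewrite -/i in i0 ik.
pose H (m : 'I_n) := [set E in P | m \notin E]; pose B (m : 'I_n) := [set E in P | m \in E].
have exch (m : 'I_n) : m < r -> #|H m| * N i.-1 <= #|B m| * N i.
  move=> mr; have HP : H m \subset P by apply/subsetP => D; rewrite inE => /andP[].
  have BP : B m \subset P by apply/subsetP => D; rewrite inE => /andP[].
  (* Two pivots meeting in at most [t] points cannot both miss [m]. *)
  have cover D D' : D \in P -> D' \in P -> #|D :&: D'| <= t -> m \in D :|: D'.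
    by move=> DP D'P /(pivots_cover hF hshift DP D'P) ->; rewrite inE ltnW.
  apply: (pivots_exchange hk hF hmax htr HP BP).
  - by move=> D; rewrite inE => /andP[/Pi].
  - by move=> D; rewrite inE => /andP[/Pi].
  - move=> D D'; rewrite inE => /andP[DP mD] D'P /(cover D D' DP D'P).
    by rewrite in_setU (negPf mD) /= => mD'; rewrite inE D'P.
  move=> D D'; rewrite inE => /andP[DP mD]; rewrite inE => /andP[D'P mD'].
  rewrite ltnNge; apply/negP => /(cover D D' DP D'P).
  by rewrite inE (negPf mD) (negPf mD').
(* Summing [exch] over [m]: each pivot contains [i.-1] of the [r] points below [r]. *)
have sumB : \sum_(m < n | m < r) #|B m| = #|P| * i.-1.
  under eq_bigr do rewrite -sum1_card.
  rewrite (exchange_big_dep (mem P)) /=; last by move=> m D _; rewrite inE => /andP[].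
  rewrite -sum_nat_const; apply: eq_bigr => D DP; have [_ Ds rD] := pivP D DP.
  rewrite -(Pi D DP) (cardsD1 r) rD /= -sum1_card; apply: eq_bigl => m.
  rewrite [D \in B m]inE DP in_setD1 /=; case: (boolP (m \in D)) => mD; rewrite ?andbF ?andbT //.
  by have := subsetP Ds m mD; rewrite inE ltnS -val_eqE ltn_neqAle => ->; rewrite andbT.
have sumH : \sum_(m < n | m < r) #|H m| + #|P| * i.-1 = #|P| * r.
  rewrite -sumB -big_split /= -[in RHS](card_seg (ltnW (ltn_ord r))) mulnC -sum_nat_const.
  apply: eq_big => [m|m _]; first by rewrite inE.
  rewrite addnC -cardsUI (_ : B m :&: H m = set0) ?cards0 ?addn0; last first.
    by apply/setP => D; rewrite in_setI [D \in B m]inE [D \in H m]inE andbACA andbN andbF inE.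
  by apply: eq_card => D; rewrite in_setU [D \in B m]inE [D \in H m]inE -andb_orr orbN andbT.
have : (\sum_(m < n | m < r) #|H m|) * N i.-1 <= (\sum_(m < n | m < r) #|B m|) * N i.
  by rewrite !big_distrl leq_sum.
(* Each pivot misses $r-(i-1) = i-t$ points below [r], because $2i = r+1+t$. *)
have -> : \sum_(m < n | m < r) #|H m| = #|P| * (i - t).
  have rE : r = i.-1 + (i - t) :> nat by lia.
  by move: sumH; rewrite {2}rE mulnDr addnC => /addnI.
rewrite sumB -!mulnA leq_pmul2l; last by rewrite card_gt0; apply/set0Pn; exists E0.
(* It remains to refute $(i-t) N(i-1) \le (i-1) N(i)$. *)
apply/negP; rewrite -ltnNge /N.
rewrite (subSn ik) (_ : k.+1 - i.-1 = (k - i).+2); last by lia.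
apply: binomial_sum_ratio; first by lia.
have [u iE] : exists u, i = t + u.+1 by exists (i - t).-1; lia.
have [e kE] : exists e, k = i + e by exists (k - i); lia.
have [t' tE] : exists t', t = t'.+1 by exists t.-1; lia.
have rE : r.+1 = i + u.+1 by lia.
have -> : k - i = e by lia.
have -> : i - t = u.+1 by lia.
rewrite rE.
have hk' : k.+1 - t = u + e + 2 by lia.
rewrite hk' in hn.
suff : i.-1 * e.+1 + u.+1 * (i + u.+1 + e) <= u.+1 * n by rewrite !mulnBr !mulnDr; lia.
apply: (@leq_trans (u.+1 * ((u + e + 2) * t.+1))); last by rewrite leq_mul2l hn orbT.
rewrite iE tE addSn /=.
(* The slack $u t' (u+e+2)$ vanishes at $u = 0$, that is $i = t+1$: there the bound on [n] is used
   in full. *)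
suff -> : u.+1 * ((u + e + 2) * t'.+2) = (t' + u.+1) * e.+1 +
    u.+1 * ((t' + u.+1).+1 + u.+1 + e) + u * t' * (u + e + 2) by exact: leq_addr.
lia.
Qed.

(** * The bound for an extremal family *)

(* Ground set [n] is modelled by 'I_n.  k - t is an integer in the paper;
   "|A triangle B| <= k - t" is written #|..| + t <= k, and
   (k - t + 1) is written k.+1 - t (truncated, equal to the integer value
   when k >= t - 1, and 0 otherwise, where the hypothesis is vacuous anyway).
   The sum over j = 0..k-t is \sum_(j < k.+1 - t), empty when k < t. *)
Theorem theorem1p2 (n k t : nat) (F : {set {set 'I_n}}) :
  1 <= t ->
  (k.+1 - t) * t.+1 <= n ->
  (forall A, A \in F -> #|A| <= k) ->
  (forall A B, A \in F -> B \in F -> #|A :&: B| < t -> #|symdiff A B| + t <= k) ->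
  #|F| <= \sum_(j < k.+1 - t) 'C(n - t, j).
Proof.
move=> t1 hn hFk hFt.
have Fadm : admissible k t F.
  apply/admissibleP; split=> // A B AF BF; have := hFt A B AF BF.
  have := card_symdiff A B; rewrite /meet_or_close; case: leqP => //= _; lia.
have [kt|tk] := ltnP k t.
  (* Comparing a member with itself already violates the condition. *)
  suff -> : F = set0 by rewrite cards0.
  apply/setP=> A; rewrite inE; apply/negP => AF.
  have := hFt A A AF AF; rewrite setIid; have := hFk A AF; lia.
have [G [Gadm FG Gmax Gweight]] := exists_max_admissible Fadm.
apply: leq_trans FG _; have [Gk _] := admissibleP _ _ _ Gadm.
(* If [f] moved a member, the compressed family would have the same size and a larger weight. *)
have stable (f : {set 'I_n} -> {set 'I_n}) :
    {in [pred A in G | f A \notin G] &, injective f} ->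
    (forall A, A \in G -> f A \notin G -> weight A < weight (f A)) ->
    admissible k t (compress f G) -> forall A, A \in G -> f A \in G.
  move=> f_inj f_lt fadm A AG; apply/negPn/negP => fA.
  have := Gweight _ fadm (card_compress f_inj).
  by rewrite leqNgt (sum_compress_lt f_inj f_lt AG fA).
have Gt : t_intersecting t G.
  apply: (upclosed_t_intersecting t1 _ Gadm); first by rewrite card_ord.
  move=> x; apply: stable; [exact: augment_inj | | exact: augment_admissible].
  by move=> A; apply: weight_augment.
have Gshift (i j : 'I_n) A : j < i -> A \in G -> shift i j A \in G.
  move=> ji; apply: stable; [exact: shift_inj | |].
    by move=> B; apply: weight_shift.
  apply: t_intersecting_admissible (shift_t_intersecting Gt).
  by move=> _ /imsetP[B BG ->]; case: ifP => _; rewrite ?card_shift Gk.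
have Gmaxt (G' : {set {set 'I_n}}) : (forall A, A \in G' -> #|A| <= k) ->
    t_intersecting t G' -> #|G'| <= #|G|.
  by move=> h1 h2; apply/Gmax/t_intersecting_admissible.
have ex_s : exists s, [forall A in G, A :&: seg n s \in G].
  exists n; apply/forall_inP => A AG; rewrite (_ : A :&: _ = A) //.
  by apply/setIidPl/subsetP => x _; rewrite inE.
case: (ex_minnP ex_s) => s /forall_inP htr smin.
have sn : s <= n.
  apply: smin; apply/forall_inP => A AG; rewrite (_ : A :&: _ = A) //.
  by apply/setIidPl/subsetP => x _; rewrite inE.
have [st|ts] := leqP s t.
  have tn : t <= n by nia.
  have := @card_cell n k t (seg n t) tn (subxx _); rewrite card_seg // => <-.
  apply/subset_leq_card/subsetP => A AG; rewrite !inE Gk // andbT.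
  have As := htr A AG; have := Gt _ _ As As; rewrite setIid => cA.
  rewrite eqEcard subsetIr card_seg //; apply: leq_trans cA _.
  apply/subset_leq_card/subsetP => x; rewrite !inE => /andP[-> /=] xs; exact: leq_trans xs st.
case: s => // r in htr smin sn ts *; pose rho := Ordinal sn.
have P0 := @pivots_eq0 n k t rho G t1 hn Gk Gt Gmaxt Gshift htr ts.
(* A member whose trace on [seg n r] left [G] would have a pivot as its trace on [seg n r.+1]; so
   [r] contradicts the minimality of [r.+1]. *)
suff : r.+1 <= r by rewrite ltnn.
apply: smin; apply/forall_inP => A AG; apply/negPn/negP => Ar.
have eqAr : A :&: seg n r = (A :&: seg n r.+1) :\ rho.
  apply/setP => x; rewrite !inE -val_eqE /= ltnS ltn_neqAle.
  by case: (x \in A); rewrite ?andbF.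
suff : A :&: seg n r.+1 \in pivots rho G by rewrite P0 inE.
rewrite inE htr // subsetIr -eqAr Ar andbT /=; apply/negPn/negP => rA.
by move: Ar; rewrite eqAr (setDidPl _) ?htr // disjoint_sym disjoints1.
Qed.
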